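(* Let $X$ be a compact metric space and $f:X\to X$ continuous such that the dynamical system $(X,f)$ is uniformly rigid. Then $(X,f)$ has shadowing if and only if $X$ is totally disconnected.
   Context: A dynamical system is a pair $(X,f)$ with $(X,d)$ a compact metric space and $f:X\to X$ continuous; $\omega$ denotes the non-negative integers. For $\delta>0$, a $\delta$-pseudo-orbit for $f$ is a sequence $\langle x_i\rangle_{i\in\omega}$ in $X$ with $d(f(x_i),x_{i+1})<\delta$ for all $i\in\omega$. $(X,f)$ has shadowing if for every $\epsilon>0$ there is $\delta>0$ such that for every $\delta$-pseudo-orbit $\langle x_i\rangle$ for $f$ there is $z\in X$ with $d(x_i,f^i(z))<\epsilon$ for all $i\in\omega$. $(X,f)$ is uniformly rigid if for every $\epsilon>0$ there is $n>0$ such that $d(f^n(x),x)<\epsilon$ for all $x\in X$. *)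

(* Defs.v *)
From HB Require Import structures.
From mathcomp Require Import all_boot all_order all_algebra.
From mathcomp Require Import all_classical all_reals topology.
Set Implicit Arguments.
Unset Strict Implicit.
Unset Printing Implicit Defensive.
Local Open Scope ring_scope.

Definition pseudo_orbit (R : realType) (X : metricType R) (f : X -> X)
    (delta : R) (x : nat -> X) : Prop :=
  forall i : nat, mdist (f (x i)) (x i.+1) < delta.

Definition shadowing (R : realType) (X : metricType R) (f : X -> X) : Prop :=
  forall eps : R, 0 < eps ->
  exists delta : R, 0 < delta /\
  forall x : nat -> X, pseudo_orbit f delta x ->
  exists z : X, forall i : nat, mdist (x i) (iter i f z) < eps.

Definition uniformly_rigid (R : realType) (X : metricType R) (f : X -> X) :
    Prop :=
  forall eps : R, 0 < eps ->
  exists n : nat, (0 < n)%N /\ forall x : X, mdist (iter n f x) x < eps.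

(* Main.v *)
Require Import Defs.
From mathcomp Require Import all_boot all_order all_algebra.
From mathcomp Require Import all_classical all_reals topology.
From mathcomp Require Import lra zify.
Import Order.TTheory GRing.Theory Num.Theory.
Local Open Scope classical_set_scope.
Local Open Scope ring_scope.

(** Both sides are equivalent to one metric condition, [small_chains]: for
every eps there is eta such that a finite sequence of jumps shorter than eta,
however long, never gets further than eps from its starting point.

For compact X, this is total disconnectedness. If chains are small, the set of
points reachable from x by eta-chains is clopen and excludes any prescribed
other point once eta is small. Conversely, the points reachable from x by
eta-chains for every eta form a connected set
([connected_chain_component]), so this set is {x}; compactness makes the
scale eta uniform ([totally_disconnected_small_chains]).

Small chains imply shadowing ([small_chains_shadowing]). By rigidity some
iterate f^n moves every point by less than eta, so, up to eta-chains, the whole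
itinerary of a point is determined by its first n terms. By uniform continuity
of those n terms, sufficiently close points therefore have eta-chained
itineraries forever. Along a pseudo-orbit x_0, x_1, ... each jump is thus
invisible to chains at all later times, and the orbit of x_0 itself stays
eta-chained to, hence within eps of, the pseudo-orbit.

Shadowing implies small chains ([shadowing_small_chains]). Let a chain lead
from a to b by jumps so small that it can be followed by a pseudo-orbit which,
at each point of the chain, first runs through n steps of its orbit, where f^n
is nearly the identity, and then jumps to the next point; at the end it stays
at b in the same manner. A point z shadowing it starts near a and is near b at
all large multiples of n. Rigidity brings z back near itself at some such
multiple, so a and b are close. *)

(** * Chains *)

Definition chained {R : realType} {X : metricType R} (e : R) (x y : X) : Prop :=
  exists2 s : seq X, path (fun a b => mdist a b < e) x s & last x s = y.

Definition small_chains {R : realType} (X : metricType R) : Prop :=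
  forall eps : R, 0 < eps ->
  exists2 eta : R, 0 < eta &
    forall x y : X, chained eta x y -> mdist x y < eps.

Section chains.
Context {R : realType} {X : metricType R}.
Implicit Types (e : R) (x y z : X).

Lemma chained_refl e x : chained e x x.
Proof. by exists [::]. Qed.

Lemma chained_trans e x y z : chained e x y -> chained e y z -> chained e x z.
Proof.
move=> [s xs <-{y}] [t st <-{z}]; exists (s ++ t); last by rewrite last_cat.
by rewrite cat_path xs.
Qed.

Lemma chained_step e x y : mdist x y < e -> chained e x y.
Proof. by move=> xy; exists [:: y] => //=; rewrite xy. Qed.

Lemma chained_le {e e' x y} : e <= e' -> chained e x y -> chained e' x y.
Proof.
move=> ee' [s xs <-]; exists s => //; apply: sub_path xs => a b /= ab.
exact: lt_le_trans ee'.
Qed.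

(** Induction along a chain: the way every confinement argument below is
run. The hypothesis that z is chained to x is what lets the confinement use
information available only at chained points. *)
Lemma chained_stable e x (P : X -> Prop) :
    (forall z w, chained e x z -> P z -> mdist z w < e -> P w) ->
  P x -> forall y, chained e x y -> P y.
Proof.
move=> step Px _ [s + <-]; elim/last_ind: s => [//|s w IH].
rewrite rcons_path last_rcons => /andP[xs sw].
by apply: (step (last x s)) (IH xs) sw; exists s.
Qed.

Lemma clopen_chained e x : 0 < e -> clopen [set y | chained e x y].
Proof.
move=> e0; split.
  rewrite openE => y /= xy; apply/nbhs_ballP; exists e => // z.
  rewrite ballEmdist /= => yz.
  exact: chained_trans xy (chained_step _ _ _ yz).
rewrite -openC openE => y /= xy; apply/nbhs_ballP; exists e => // z.
rewrite ballEmdist /= => yz xz; apply: xy; apply: chained_trans xz _.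
by apply: chained_step; rewrite metric_sym.
Qed.

(** The only form in which compactness enters: a property that holds locally at
all small scales holds globally at one scale. *)
Lemma compact_uniform_scale (P : R -> X -> Prop) : compact [set: X] ->
    (forall x, exists2 r, 0 < r &
       forall e y, 0 < e -> e < r -> mdist x y < r -> P e y) ->
  exists2 e, 0 < e & forall x, P e x.
Proof.
move=> /compact_near_coveringP cX locP.
have : \forall e \near (0 : R)^'+, [set: X] `<=` P e.
  apply: cX => x _; have [r r0 rP] := locP x.
  exists (ball x r, [set e | 0 < e < r]) => /=.
    split; first exact: nbhsx_ballx.
    near=> e => /=; apply/andP; split; near: e; first exact: nbhs_right_gt.
    exact: nbhs_right_lt.
  by move=> [y e] /= [+ /andP[e0 er]]; rewrite ballEmdist => xy; exact: rP.
move=> Pe.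
have [e [e0 eP]] : exists e, 0 < e /\ [set: X] `<=` P e.
  apply: (@filter_ex _ (0 : R)^'+); apply: filterS2 Pe (nbhs_right_gt 0).
  by [].
by exists e => // x; exact: eP.
Unshelve. all: by end_near. Qed.


(** * Chain components in compact metric spaces *)

Definition chain_component (x : X) : set X :=
  [set y | forall e, 0 < e -> chained e x y].

Lemma chain_component_refl x : chain_component x x.
Proof. by move=> e _; exact: chained_refl. Qed.

Lemma closed_chain_component x : closed (chain_component x).
Proof.
rewrite (_ : chain_component x =
    \bigcap_(e in [set e | 0 < e]) [set y | chained e x y]) //.
by apply: closed_bigI => e /= /(clopen_chained _ x)[].
Qed.

(** The points e-chained to x decrease to the chain component as e tends to 0,
so by compactness they eventually enter any of its neighbourhoods. *)
Lemma chained_near_component (x : X) (rho : R) : compact [set: X] -> 0 < rho ->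
  exists2 e, 0 < e & forall z, chained e x z ->
    exists2 p, chain_component x p & mdist p z < rho.
Proof.
move=> cX rho0.
apply: (compact_uniform_scale (fun e z => chained e x z ->
    exists2 p, chain_component x p & mdist p z < rho)) => // z.
(* Off the component, z is not chained to x at some scale e; then neither is
   any point within e of z at any smaller scale. *)
have [Kz|] := pselect (chain_component x z).
  by exists rho => // e y _ _ zy _; exists z.
move=> /existsNP[e /not_implyP[e0 nxz]].
exists e => // e' y _ e'e zy xy; exfalso; apply: nxz.
apply: chained_trans (chained_le (ltW e'e) xy) _.
by apply: chained_step; rewrite metric_sym.
Qed.

Lemma not_closure_ball (A : set X) x :
  ~ closure A x -> exists2 r, 0 < r & forall y, mdist x y < r -> ~ A y.
Proof.
move=> nAx; have /nbhs_ballP[r /= r0 rA] : nbhs x (~` A).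
  by rewrite -[nbhs _ _]/(interior _ _) interiorC.
by exists r => // y xy; apply: rA; rewrite ballEmdist.
Qed.

Lemma disjoint_closure_gap (A B : set X) : compact [set: X] ->
  closure A `&` closure B = set0 ->
  exists2 e, 0 < e & forall y, A y -> forall w, B w -> e <= mdist y w.
Proof.
move=> cX AB0; apply: (compact_uniform_scale (fun e y => A y ->
    forall w, B w -> e <= mdist y w)) => // x.
have [Ax|nAx] := pselect (closure A x); last first.
  have [r r0 rA] := not_closure_ball _ _ nAx.
  by exists r => // e y _ _ /rA.
have [r r0 rB] : exists2 r, 0 < r & forall y, mdist x y < r -> ~ B y.
  apply: not_closure_ball => Bx.
  by have : (closure A `&` closure B) x by []; rewrite AB0.
exists (r / 2); first by rewrite divr_gt0.
move=> e y _ er xy _ w Bw; rewrite leNgt; apply/negP => yw; apply: rB Bw.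
have := metric_triangle x y w; lra.
Qed.

(** A separation of the component into two pieces would leave a gap rho between
them. Fine chains stay within rho / 3 of the component and have jumps shorter
than rho / 3, so they cannot cross the gap; but every point of the component
is reached from x by such chains. *)
Lemma connected_chain_component x :
  compact [set: X] -> connected (chain_component x).
Proof.
move=> cX; apply/connectedP => E [E0 EU sE].
wlog Ex : E E0 EU sE / E false x.
  move=> wl; have : chain_component x x by exact: chain_component_refl.
  rewrite EU => -[Ex|Ex]; first exact: (wl E).
  by apply: (wl (E \o negb)) => //; [case => /=|rewrite EU setUC|
    rewrite separatedC].
have [rho rho0 gap] : exists2 e, 0 < e &
    forall y, E false y -> forall w, E true w -> e <= mdist y w.
  apply: disjoint_closure_gap => //; apply/seteqP; split => // y [E0y E1y].
  have : closure (chain_component x) y.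
    by rewrite EU; apply: closureS E0y => z; left.
  rewrite -(closure_id _).1; last exact: closed_chain_component.
  case: sE => sE1 sE2; rewrite EU => -[Ey|Ey].
    by have : (E false `&` closure (E true)) y by []; rewrite sE2.
  by have : (closure (E false) `&` E true) y by []; rewrite sE1.
have rho30 : 0 < rho / 3 by rewrite divr_gt0.
have [e e0 near_component] := chained_near_component x _ cX rho30.
have e'0 : 0 < Num.min e (rho / 3) by rewrite lt_min e0.
have near_false : forall z, chained (Num.min e (rho / 3)) x z ->
    exists2 p, E false p & mdist p z < rho / 3.
  apply: chained_stable; last by exists x; rewrite ?mdistxx.
  move=> z w xz [p Ep pz]; rewrite lt_min => /andP[zw zw'].
  have [|q] := near_component w.
    apply: chained_trans (chained_le _ xz) (chained_step _ _ _ zw).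
    by rewrite ge_min lexx.
  rewrite EU => -[Eq|Eq] qw; first by exists q.
  have := gap _ Ep _ Eq; rewrite (metric_sym q) in qw.
  have := metric_triangle p z q; have := metric_triangle z w q; lra.
have [q Eq] := E0 true.
have [|p Ep pq] := near_false q.
  by have : chain_component x q by [rewrite EU; right]; exact.
by have := gap _ Ep _ Eq; lra.
Qed.

(** The chain component of x is connected, hence equal to {x}, so fine chains
from x stay near x; a scale valid at x is valid at all points close to x
because chains from these can be started at x. *)
Lemma totally_disconnected_small_chains : compact [set: X] ->
  totally_disconnected [set: X] -> small_chains X.
Proof.
move=> cX tdX eps eps0; apply: (compact_uniform_scale (fun e x =>
  forall y, chained e x y -> mdist x y < eps)) => // x.
have eps20 : 0 < eps / 2 by rewrite divr_gt0.
have [e e0 near_x] := chained_near_component x _ cX eps20.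
exists (Num.min e (eps / 2)); first by rewrite lt_min e0.
move=> e' x' _; rewrite !lt_min => /andP[e'e _] /andP[xx' xx'2] y x'y.
have [|p xp py] := near_x y.
  exact: chained_trans (chained_step _ _ _ xx') (chained_le (ltW e'e) x'y).
have px : p = x.
  have : connected_component [set: X] x p.
    apply: (connected_component_max _ _ _ xp) => //.
      exact: chain_component_refl.
    exact: connected_chain_component.
  by rewrite tdX.
rewrite px in py; rewrite metric_sym in xx'2.
by have := metric_triangle x' x y; lra.
Qed.

(** Two points at distance d are separated by the clopen set of points
reachable from one of them by chains too fine to travel the distance d. *)
Lemma small_chains_totally_disconnected :
  small_chains X -> totally_disconnected [set: X].
Proof.
move=> scX; apply: zero_dimension_totally_disconnected => x y xy.
have [eta eta0 small] := scX (mdist x y) (eqbRL (mdist_gt0 x y) xy).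
exists [set z | chained eta x z]; split; first exact: clopen_chained.
  exact: chained_refl.
by move=> /small; rewrite ltxx.
Qed.

End chains.

(** * Shadowing for uniformly rigid maps *)

Section rigid.
Context {R : realType} {X : metricType R} (f : X -> X).

Lemma iter_uniformly_continuous (n : nat) (eta : R) : compact [set: X] ->
    continuous f -> 0 < eta ->
  exists2 delta, 0 < delta & forall x y, mdist x y < delta ->
    forall i, (i < n)%N -> mdist (iter i f x) (iter i f y) < eta.
Proof.
move=> cX cf eta0; elim: n => [|n [d d0 IH]]; first by exists 1.
have [d' d'0 fd] : exists2 e, 0 < e & forall x y, mdist x y < e ->
    mdist (f x) (f y) < d.
  apply: (compact_uniform_scale (fun e x => forall y, mdist x y < e ->
    mdist (f x) (f y) < d)) => // x.
  have d20 : 0 < d / 2 by rewrite divr_gt0.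
  have /(_ _ (nbhsx_ballx _ _ d20))/nbhs_ballP[r /= r0 rf] := cf x.
  have {}rf y : mdist x y < r -> mdist (f x) (f y) < d / 2.
    by have := rf y; rewrite /= !ballEmdist; apply.
  exists (r / 2); first by rewrite divr_gt0.
  move=> e y _ er xy w yw.
  have /rf fxw : mdist x w < r by have := metric_triangle x y w; lra.
  have /rf fxy : mdist x y < r by lra.
  rewrite metric_sym in fxy.
  by have := metric_triangle (f y) (f x) (f w); lra.
exists (Num.min d' eta); first by rewrite lt_min d'0.
move=> x y; rewrite lt_min => /andP[xy xy'] [//|i] ni; rewrite !iterSr.
by apply: IH => //; exact: fd.
Qed.

(** The orbit of the initial point of the pseudo-orbit shadows it. Being chained
at all future times is preserved by f and is implied by closeness; so, unlike
closeness, it accumulates no error along the pseudo-orbit. *)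
Lemma small_chains_shadowing : compact [set: X] -> continuous f ->
  uniformly_rigid f -> small_chains X -> shadowing f.
Proof.
move=> cX cf rigid scX eps /scX[eta eta0 small].
have [n [n0 fn]] := rigid eta eta0.
have [delta delta0 unif] := iter_uniformly_continuous n _ cX cf eta0.
(* Beyond time n, a chain between the two orbits is pulled back by n steps:
   f^n moves each endpoint by less than eta. *)
have same_itinerary x y : mdist x y < delta ->
    forall i, chained eta (iter i f x) (iter i f y).
  move=> xy; elim/ltn_ind => i IH.
  have [ltin|leni] := ltnP i n; first exact/chained_step/unif.
  rewrite -(subnKC leni) !iterD.
  apply: chained_trans (chained_step _ _ _ (fn _)) _.
  apply: chained_trans (IH (i - n)%N _) _; first lia.
  by apply: chained_step; rewrite metric_sym.
exists delta; split => // x xP; exists (x 0%N) => i.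
rewrite metric_sym; apply: small.
(* Chains at every future time k are needed for the induction on i. *)
suff tracks k : chained eta (iter k f (iter i f (x 0%N))) (iter k f (x i)).
  exact: (tracks 0%N).
elim: i k => [|i IH] k; first exact: chained_refl.
rewrite iterS -iterSr; apply: chained_trans (IH k.+1) _.
by rewrite iterSr; exact: same_itinerary (xP i) k.
Qed.

(** Return times to the identity can be chosen among the multiples of k, and
hence arbitrarily large: if f^m is within eps / (k + 1) of the identity, then
f^(m k) is within k eps / (k + 1) of it. *)
Lemma uniformly_rigid_multiple (k : nat) (eps : R) : uniformly_rigid f ->
    0 < eps ->
  exists m, (0 < m)%N /\ forall x, mdist (iter (m * k) f x) x < eps.
Proof.
move=> rigid eps0.
have [|m [m0 fm]] := rigid (eps / k.+1%:R); first by rewrite divr_gt0.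
exists m; split => // x; apply: (@le_lt_trans _ _ (k%:R * (eps / k.+1%:R))).
  elim: {1 2}k => [|j IH]; first by rewrite muln0 mdistxx mul0r.
  rewrite mulnS iterD -natr1 mulrDl mul1r addrC.
  apply: le_trans (metric_triangle _ (iter (m * j) f x) _) _.
  by apply: lerD => //; exact/ltW.
by rewrite mulrA ltr_pdivrMr // mulrC ltr_pM2l // ltr_nat.
Qed.

(** The sequence y followed at speed 1 / n: each y j runs through the first n
points of its orbit before the jump to y j.+1. *)
Definition slow_orbit (n : nat) (y : nat -> X) (i : nat) : X :=
  iter (i %% n) f (y (i %/ n)%N).

Lemma slow_orbit_multiple n y j : (0 < n)%N -> slow_orbit n y (j * n) = y j.
Proof. by move=> n0; rewrite /slow_orbit modnMl mulnK. Qed.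

Lemma slow_orbit_pseudo_orbit n (y : nat -> X) (delta : R) : (0 < n)%N ->
    0 < delta ->
    (forall x, mdist (iter n f x) x < delta / 2) ->
    (forall j, mdist (y j) (y j.+1) < delta / 2) ->
  pseudo_orbit f delta (slow_orbit n y).
Proof.
move=> n0 delta0 fn yy i; rewrite /slow_orbit -iterS modnS divnS //.
have [ni|ni] := boolP (n %| i.+1)%N; last by rewrite add0n mdistxx.
have -> : (i %% n).+1 = n.
  apply/eqP; rewrite eqn_leq ltn_pmod //= dvdn_leq //.
  by rewrite -(dvdn_addr _ (dvdn_mull (i %/ n) (dvdnn n))) addnS -divn_eq.
rewrite add1n /=.
have := metric_triangle (iter n f (y (i %/ n)%N)) (y (i %/ n)%N)
  (y (i %/ n).+1).
have := fn (y (i %/ n)%N); have := yy (i %/ n)%N; lra.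
Qed.

(** The chain, prolonged by its constant end point b, is turned into a
pseudo-orbit. A shadowing point z is close to b at every multiple j n with j at
least the length of the chain, and rigidity returns z near its initial
position, which is close to a, at one of these times. *)
Lemma shadowing_small_chains :
  uniformly_rigid f -> shadowing f -> small_chains X.
Proof.
move=> rigid shadow eps eps0.
have eps30 : 0 < eps / 3 by rewrite divr_gt0.
have [delta [delta0 trace]] := shadow _ eps30.
have delta20 : 0 < delta / 2 by rewrite divr_gt0.
exists (delta / 2) => // a _ [s sP <-].
have [n [n0 fn]] := rigid _ delta20.
(* The default value b of nth prolongs the chain for ever. *)
set b := last a s; pose y := nth b (a :: s).
have y_end j : (size s <= j)%N -> y j = b.
  rewrite leq_eqVlt => /orP[/eqP <-|sj]; last by rewrite /y nth_default.
  by rewrite /y nth_last.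
have yy j : mdist (y j) (y j.+1) < delta / 2.
  have [js|sj] := ltnP j (size s); first exact: (pathP b sP).
  by rewrite !y_end ?mdistxx // ltnW.
have [z zP] := trace _ (slow_orbit_pseudo_orbit _ _ _ n0 delta0 fn yy).
have [m [m0 fm]] := uniformly_rigid_multiple (size s * n) _ rigid eps30.
have az : mdist a z < eps / 3.
  by have := zP 0%N; rewrite -[0%N]/(0 * n)%N slow_orbit_multiple.
have bz : mdist b (iter (m * (size s * n)) f z) < eps / 3.
  have := zP (m * size s * n)%N; rewrite slow_orbit_multiple // mulnA y_end //.
  by rewrite leq_pmull.
rewrite metric_sym in bz.
have := metric_triangle a z b.
have := metric_triangle z (iter (m * (size s * n)) f z) b.
have zw := fm z; rewrite metric_sym in zw; lra.
Qed.

End rigid.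

Theorem theorem11 (R : realType) (X : metricType R) (f : X -> X)
  (X_compact : compact [set: X]) (f_continuous : continuous f)
  (f_rigid : uniformly_rigid f) :
  shadowing f <-> totally_disconnected [set: X].
Proof.
split=> [f_shadowing|tdX].
  apply: small_chains_totally_disconnected.
  exact: shadowing_small_chains f_rigid f_shadowing.
apply: small_chains_shadowing => //.
exact: totally_disconnected_small_chains.
Qed.
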